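(* The complete graph $K_n$ admits an empty-ply drawing if and only if $n\le 7$.
   Context: A straight-line drawing of a graph places each vertex at a distinct point of the plane and draws each edge as the straight-line segment between its endpoints (edges are allowed to overlap). For each vertex $v$, the ply-disk $D_v$ is the open disk centered at $v$ with radius equal to half the length of the longest edge incident to $v$. A drawing is empty-ply if every ply-disk $D_v$ contains no vertex other than $v$ in its interior. *)

(* Defs.v *)
From HB Require Import structures.
From mathcomp Require Import all_boot all_order all_algebra.
From mathcomp Require Import classical_sets reals.

Set Implicit Arguments.
Unset Strict Implicit.
Unset Printing Implicit Defensive.

Import Order.TTheory GRing.Theory Num.Theory.

Local Open Scope ring_scope.
Local Open Scope classical_set_scope.

Record simple_graph := SimpleGraph {
  vertex :> finType;
  adj : rel vertex;
  adj_sym : symmetric adj;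
  adj_irrefl : irreflexive adj }.

Definition complete_rel (n : nat) : rel 'I_n := fun u v => u != v.
Arguments complete_rel n u v /.

Lemma complete_rel_sym n : symmetric (@complete_rel n).
Proof. by move=> u v /=; rewrite eq_sym. Qed.

Lemma complete_rel_irrefl n : irreflexive (@complete_rel n).
Proof. by move=> u /=; rewrite eqxx. Qed.

Definition complete_graph (n : nat) : simple_graph :=
  SimpleGraph (@complete_rel_sym n) (@complete_rel_irrefl n).

Section Drawing.
Variable R : realType.

(* The library norm on R * R is the sup norm, hence this explicit Euclidean
   distance. *)
Definition dist (a b : R * R) : R :=
  Num.sqrt ((a.1 - b.1) ^+ 2 + (a.2 - b.2) ^+ 2).

Definition open_disk (c : R * R) (r : R) : set (R * R) :=
  [set x | dist c x < r].

Variable G : simple_graph.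

(* A straight-line drawing is determined by its vertex positions: edge uv is
   the segment from p u to p v, whose length is dist (p u) (p v). *)
Definition straight_line_drawing (p : G -> R * R) : Prop := injective p.

(* Equals 0 when v has no incident edge. *)
Definition longest_edge (p : G -> R * R) (v : G) : R :=
  \big[Num.max/0]_(u : G | adj v u) dist (p v) (p u).

Definition ply_disk (p : G -> R * R) (v : G) : set (R * R) :=
  open_disk (p v) (longest_edge p v / 2).

Definition empty_ply (p : G -> R * R) : Prop :=
  forall v u : G, u != v -> ~ ply_disk p v (p u).

Definition admits_empty_ply_drawing : Prop :=
  exists p : G -> R * R, straight_line_drawing p /\ empty_ply p.

End Drawing.

(* Main.v *)
From Stdlib Require Import ZArith.
Require Import Defs.
From mathcomp Require Import all_boot all_order all_algebra.
From mathcomp Require Import reals.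
From mathcomp Require Import ssrZ ring lra.

(** Emptiness of the ply-disks of K_n means |uw| <= 2 |uv| for all vertices
    u <> v and w.  The regular hexagon with its centre satisfies this, its
    distances lying between the side and twice the side.

    For eight points, put a farthest pair at (-64, 0) and (64, 0).  Every other
    point then lies in one of eight zones, four in each half-plane: around the
    centre, on the left, on the right, and at the top.  No zone holds two
    points, and certain pairs, triples and quadruples of zones cannot all be
    occupied; any six of the eight zones include such an excluded family, so
    six further points do not fit.  Each exclusion is established by bisecting
    the boxes that contain the points until one of the inequalities
    |ps| <= 2 |pq| or |pq| <= 128 fails throughout every product of boxes. *)

Set Implicit Arguments.
Unset Strict Implicit.
Unset Printing Implicit Defensive.

Import Order.TTheory GRing.Theory Num.Theory.

Local Open Scope ring_scope.

(** * Bisection search on integer boxes *)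

Definition interval_Z : Type := (Z * Z)%type.
Definition box : Type := (interval_Z * interval_Z)%type.

Section BranchAndBound.
Local Open Scope Z_scope.

Definition gap (e : Z) (s : interval_Z) : Z :=
  Z.max 0 (Z.max (s.1 - e) (e - s.2)).

Definition excess_at (e : Z) (q s : interval_Z) : Z :=
  let d := Z.max (e - q.1) (q.2 - e) in
  let g := gap e s in
  4 * (d * d) - g * g.

(* The exact maximum of 4 (x - y)^2 - (x - z)^2 for x in p, y in q, z in s:
   by convexity in x it is attained at an endpoint of p. *)
Definition excess (p q s : interval_Z) : Z :=
  Z.max (excess_at p.1 q s) (excess_at p.2 q s).

(** Squared distances split over the coordinates, so the sum of the two maxima bounds
    [4 |pq|^2 - |ps|^2] on the boxes. *)
Definition ratio_conflict (p q s : box) : bool :=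
  excess p.1 q.1 s.1 + excess p.2 q.2 s.2 <? 0.

Definition separation (p q : interval_Z) : Z :=
  Z.max 0 (Z.max (q.1 - p.2) (p.1 - q.2)).

Definition diameter_conflict (p q : box) : bool :=
  let dx := separation p.1 q.1 in
  let dy := separation p.2 q.2 in
  128 * 128 <? dx * dx + dy * dy.

Definition box0 : box := ((0, 0), (0, 0)).

Definition triple : Type := (nat * nat * nat)%type.

Definition conflict (ts : seq triple) (ps : seq (nat * nat)) (bs : seq box) :
    bool :=
  let b := nth box0 bs in
  if has (fun t => ratio_conflict (b t.1.1) (b t.1.2) (b t.2)) ts then true
  else has (fun t => diameter_conflict (b t.1) (b t.2)) ps.

Definition widest (bs : seq box) : nat * bool :=
  (foldl (fun best i =>
      let b := nth box0 bs i in
      let wx := b.1.2 - b.1.1 in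
      let wy := b.2.2 - b.2.1 in
      let best := if best.2 <? wx then ((i, false), wx) else best in
      if best.2 <? wy then ((i, true), wy) else best)
    ((0%N, false), 0) (iota 0 (size bs))).1.

Definition halve (i : interval_Z) : interval_Z * interval_Z :=
  let m := (i.1 + i.2) / 2 in ((i.1, m), (m, i.2)).

Definition bisect (vertical : bool) (b : box) : box * box :=
  if vertical then let h := halve b.2 in ((b.1, h.1), (b.1, h.2))
  else let h := halve b.1 in ((h.1, b.2), (h.2, b.2)).

(* Conditionals, not [||] and [&&], which [vm_compute] evaluates eagerly. *)
Fixpoint refute (ts : seq triple) (ps : seq (nat * nat)) (depth : nat)
    (bs : seq box) : bool :=
  if conflict ts ps bs then true else
  if depth is d.+1 then
    let w := widest bs in
    let h := bisect w.2 (nth box0 bs w.1) in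
    if refute ts ps d (set_nth box0 bs w.1 h.1)
    then refute ts ps d (set_nth box0 bs w.1 h.2) else false
  else false.

End BranchAndBound.

(** * Soundness of the search over the reals *)

Definition sqdist (R : realType) (a b : R * R) : R :=
  (a.1 - b.1) ^+ 2 + (a.2 - b.2) ^+ 2.

Section Soundness.
Variable R : realType.
Implicit Types (x y z : R) (i j k : interval_Z) (b : box) (p q s : R * R).

Definition real_of_Z (n : Z) : R := (int_of_Z n)%:~R.
Local Notation "n %:ZR" := (real_of_Z n) (at level 2, format "n %:ZR").

Lemma real_of_ZD m n : (Z.add m n)%:ZR = m%:ZR + n%:ZR.
Proof. by rewrite /real_of_Z (rmorphD int_of_Z) intrD. Qed.

Lemma real_of_ZN m : (Z.opp m)%:ZR = - m%:ZR.
Proof. by rewrite /real_of_Z (rmorphN int_of_Z) intrN. Qed.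

Lemma real_of_ZB m n : (Z.sub m n)%:ZR = m%:ZR - n%:ZR.
Proof. by rewrite /Z.sub real_of_ZD real_of_ZN. Qed.

Lemma real_of_ZM m n : (Z.mul m n)%:ZR = m%:ZR * n%:ZR.
Proof. by rewrite /real_of_Z (rmorphM int_of_Z) intrM. Qed.

Lemma real_of_Z_ge0 m : Z.le Z0 m -> 0 <= m%:ZR.
Proof. by case: m => // n _; rewrite /real_of_Z ler0z. Qed.

Lemma ler_real_of_Z m n : Z.le m n -> m%:ZR <= n%:ZR.
Proof.
move=> mn; rewrite -subr_ge0 -real_of_ZB; apply: real_of_Z_ge0.
by apply/Z.le_0_sub.
Qed.

Lemma ltr_real_of_Z m n : Z.ltb m n -> m%:ZR < n%:ZR.
Proof.
move/Z.ltb_lt => mn; have := ler_real_of_Z (proj2 (Z.le_succ_l _ _) mn).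
by rewrite -Z.add_1_r real_of_ZD => /(lt_le_trans _); apply; rewrite ltrDl.
Qed.

Lemma real_of_Z_max m n : (Z.max m n)%:ZR = Num.max m%:ZR n%:ZR.
Proof.
case: (Z.max_spec m n) => -[mn ->].
  by rewrite max_r // ler_real_of_Z //; apply: Z.lt_le_incl.
by rewrite max_l // ler_real_of_Z.
Qed.

(** With [u] and [v] the signed gaps on the two sides, the left-hand side is the squared distance to
    an interval, or between two intervals. *)
Lemma sqr_max0_le (u v t : R) : u <= - t -> v <= t ->
  Num.max 0 (Num.max u v) ^+ 2 <= t ^+ 2.
Proof.
move=> ut vt; rewrite -[t ^+ 2]real_normK ?num_real //.
rewrite lerXn2r ?nnegrE ?le_max ?lexx //.
rewrite !ge_max normr_ge0 (le_trans vt) ?ler_norm // (le_trans ut) //.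
by rewrite ler_normr lexx orbT.
Qed.

Definition in_interval (i : interval_Z) (x : R) : bool :=
  (i.1%:ZR <= x) && (x <= i.2%:ZR).

Definition in_box (b : box) (p : R * R) : bool :=
  in_interval b.1 p.1 && in_interval b.2 p.2.

Lemma le_excess_at (e : Z) (q s : interval_Z) y z :
  in_interval q y -> in_interval s z ->
  4 * (e%:ZR - y) ^+ 2 - (e%:ZR - z) ^+ 2 <= (excess_at e q s)%:ZR.
Proof.
move=> /andP[qy yq] /andP[sz zs].
rewrite /excess_at real_of_ZB !real_of_ZM -!expr2.
have -> : (Zpos 4)%:ZR = 4 :> R by [].
have le_d : (e%:ZR - y) ^+ 2 <=
    (Z.max (Z.sub e q.1) (Z.sub q.2 e))%:ZR ^+ 2.
  rewrite real_of_Z_max !real_of_ZB.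
  set d := Num.max _ _.
  have d1 : e%:ZR - q.1%:ZR <= d by rewrite le_max lexx.
  have d2 : q.2%:ZR - e%:ZR <= d by rewrite le_max lexx orbT.
  by nra.
have le_g : (gap e s)%:ZR ^+ 2 <= (e%:ZR - z) ^+ 2.
  rewrite /gap !real_of_Z_max !real_of_ZB.
  by apply: sqr_max0_le; lra.
by lra.
Qed.

Lemma le_excess (p q s : interval_Z) x y z :
  in_interval p x -> in_interval q y -> in_interval s z ->
  4 * (x - y) ^+ 2 - (x - z) ^+ 2 <= (excess p q s)%:ZR.
Proof.
move=> /andP[px xp] qy sz; rewrite /excess real_of_Z_max le_max.
(* The tested sum is the slope from [p.1] to [x] of the convex quadratic to be bounded; if it is
   positive, so is the slope from [x] to [p.2]. *)
have [le0|gt0] := lerP (3 * (p.1%:ZR + x) - 8 * y + 2 * z) 0.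
  by rewrite (le_trans _ (le_excess_at p.1 qy sz)) //; nra.
by rewrite (le_trans _ (le_excess_at p.2 qy sz)) ?orbT //; nra.
Qed.

Lemma ratio_conflictF bp bq bs p q s :
  in_box bp p -> in_box bq q -> in_box bs s ->
  sqdist p s <= 4 * sqdist p q -> ratio_conflict bp bq bs = false.
Proof.
move=> /andP[p1 p2] /andP[q1 q2] /andP[s1 s2]; rewrite /sqdist => h.
apply/negP => /ltr_real_of_Z; rewrite real_of_ZD.
have -> : Z0%:ZR = 0 :> R by [].
by have := le_excess p1 q1 s1; have := le_excess p2 q2 s2; lra.
Qed.

Lemma separation_le i j x y : in_interval i x -> in_interval j y ->
  (separation i j)%:ZR ^+ 2 <= (x - y) ^+ 2.
Proof.
move=> /andP[ix xi] /andP[jy yj].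
rewrite /separation !real_of_Z_max !real_of_ZB.
by apply: sqr_max0_le; lra.
Qed.

Lemma diameter_conflictF bp bq p q : in_box bp p -> in_box bq q ->
  sqdist p q <= 128 ^+ 2 -> diameter_conflict bp bq = false.
Proof.
move=> /andP[p1 p2] /andP[q1 q2]; rewrite /sqdist => h.
apply/negP => /ltr_real_of_Z; rewrite real_of_ZD !real_of_ZM -!expr2.
have -> : (Zpos 128)%:ZR = 128 :> R by [].
by have := separation_le p1 q1; have := separation_le p2 q2; lra.
Qed.

(** The cut point lies in both halves, so rounding in the integer division loses no point. *)
Lemma in_halve i x : in_interval i x ->
  in_interval (halve i).1 x || in_interval (halve i).2 x.
Proof.
move=> /andP[ix xi]; rewrite /in_interval /= ix xi /= andbT.
exact: le_total.
Qed.

Lemma in_bisect v b p : in_box b p ->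
  in_box (bisect v b).1 p || in_box (bisect v b).2 p.
Proof.
by case: v => /andP[b1 b2]; rewrite /in_box /= ?b1 ?b2 ?andbT; apply: in_halve.
Qed.

(** An actual configuration survives in one half of each bisection and never yields a conflict, so
    the search runs out of depth. *)
Lemma refuteF ts ps depth (bs : seq box) (P : nat -> R * R) :
  (forall t, t \in ts ->
    sqdist (P t.1.1) (P t.2) <= 4 * sqdist (P t.1.1) (P t.1.2)) ->
  (forall t, t \in ps -> sqdist (P t.1) (P t.2) <= 128 ^+ 2) ->
  (forall n, in_box (nth box0 bs n) (P n)) ->
  refute ts ps depth bs = false.
Proof.
move=> ratioP diamP; elim: depth bs => [|d IHd] bs bsP.
all: have cF : conflict ts ps bs = false.
1,3: apply/norP; split; apply/hasPn => t tt; apply/negbT.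
1,3: by apply: ratio_conflictF (bsP _) (bsP _) (bsP _) (ratioP _ tt).
1,2: by apply: diameter_conflictF (bsP _) (bsP _) (diamP _ tt).
  by rewrite /= cF.
rewrite /= cF /=; set i := (widest bs).1; set v := (widest bs).2.
apply/negP => /andP[r1 r2].
have /orP[h|h] := in_bisect v (bsP i).
- move: r1; rewrite IHd // => j; rewrite nth_set_nth /=.
  by have [->|_] := eqVneq j i.
- move: r2; rewrite IHd // => j; rewrite nth_set_nth /=.
  by have [->|_] := eqVneq j i.
Qed.

End Soundness.

(** * Zones and excluded families *)

Section Zones.
Local Open Scope Z_scope.

Definition left_end : box := ((-64, -64), (0, 0)).
Definition right_end : box := ((64, 64), (0, 0)).

(* The two central zones are narrow because the points keep distance 64 from
   both ends, and |x| <= 48 because they are moreover within 128 of them. *)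
Definition zones : seq box :=
  [:: ((-12, 12), (0, 36)); ((-48, 0), (36, 86)); ((0, 48), (36, 86));
      ((-48, 48), (86, 128));
      ((-12, 12), (-36, 0)); ((-48, 0), (-86, -36)); ((0, 48), (-86, -36));
      ((-48, 48), (-128, -86))].

End Zones.

(* Index triples (i, j, k) of the inequalities |ik| <= 2 |ij| to be tried, 0 and
   1 being the ends.  For six boxes, a subset that suffices for the exclusions,
   as trying all of them would make the search ten times slower. *)
Definition triples (m : nat) : seq triple :=
  if m == 6 then
    [:: (5, 4, 3); (3, 2, 5); (4, 2, 3); (1, 2, 0); (0, 2, 1); (2, 4, 0);
        (0, 4, 1); (1, 4, 0); (2, 4, 5); (0, 3, 1); (1, 3, 0); (2, 4, 1);
        (1, 5, 0); (0, 5, 1)]%N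
  else
    let ijs := [seq (i, j) | i <- iota 0 m, j <- iota 0 m] in
    [seq t <- [seq (ij, k) | ij <- ijs, k <- iota 0 m] | t.1.1 != t.1.2].

Definition pairs (m : nat) : seq (nat * nat) :=
  if m == 6 then [:: (3, 5)]%N else [seq (i, j) | i <- iota 0 m, j <- iota 0 m].

(** The range checks let [clashF] read indices as vertices, and distinctness is what the ratio
    inequality requires. The depth 40 only bounds the recursion. *)
Definition clash (ks : seq nat) : bool :=
  let m := (size ks).+2 in
  [&& all (fun t => [&& t.1.1 != t.1.2, t.1.1 < m, t.1.2 < m & t.2 < m])%N
        (triples m),
      all (fun t => (t.1 < m) && (t.2 < m))%N (pairs m)
    & refute (triples m) (pairs m) 40
        [:: left_end, right_end & [seq nth box0 zones k | k <- ks]]].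

(** The list is closed under the reflections in the axes: one exchanges [k] and [k + 4] modulo 8,
    the other 1 with 2 and 5 with 6. Up to these there are four families. *)
Definition exclusions : seq (seq nat) :=
  [:: [:: 3; 7]; [:: 3; 5; 6]; [:: 3; 4; 5]; [:: 3; 4; 6]; [:: 7; 1; 2];
      [:: 7; 0; 1]; [:: 7; 0; 2]; [:: 0; 1; 4; 6]; [:: 0; 2; 4; 5]]%N.

Lemma zone_clash : all (fun k => clash [:: k; k]) (iota 0 8).
Proof. by vm_compute. Qed.

Lemma exclusion_clash : all clash exclusions.
Proof. by vm_compute. Qed.

Lemma exclusion_six (s : seq nat) : uniq s -> all (fun k => k < 8)%N s ->
  (6 <= size s)%N -> has (fun ks => all (mem s) ks) exclusions.
Proof.
move=> us s8.
(* With the size as a count over the eight zones, the goal depends on eight Booleans only, and every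
   case computes. *)
have -> : size s = count (mem s) (iota 0 8).
  rewrite -size_filter; apply/perm_size/uniq_perm => //.
    by rewrite filter_uniq ?iota_uniq.
  move=> k; rewrite mem_filter mem_iota /= andb_idr //.
  by move: k; apply/allP.
rewrite /exclusions /=.
by do 8?[case: (_ \in s)].
Qed.

(** Serves to pick vertices that occupy the zones of an excluded family. *)
Lemma map_lift (T : eqType) (f : T -> nat) (e : seq T) (ks : seq nat) :
  {subset ks <= map f e} -> exists2 vs, map f vs = ks & {subset vs <= e}.
Proof.
elim: ks => [|k ks IH] sub; first by exists [::].
have [|vs <- vse] := IH; first by move=> i ik; apply: sub; rewrite inE ik orbT.
have /mapP[v ve ->] : k \in map f e by apply: sub; rewrite inE eqxx.
by exists (v :: vs) => // w; rewrite inE => /predU1P[->|/vse].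
Qed.

(** * At most seven points in normalized position *)

Section Normalized.
Variables (R : realType) (T : finType) (Q : T -> R * R) (a b : T).
Hypothesis Qa : Q a = (- 64, 0).
Hypothesis Qb : Q b = (64, 0).
Hypothesis ratioQ : forall u v w, u != v ->
  sqdist (Q u) (Q w) <= 4 * sqdist (Q u) (Q v).
Hypothesis diamQ : forall u v, sqdist (Q u) (Q v) <= 128 ^+ 2.

Definition zone (v : T) : nat := find (fun z => in_box z (Q v)) zones.


Lemma has_zone v : v != a -> v != b -> has (fun z => in_box z (Q v)) zones.
Proof.
rewrite 2![v == _]eq_sym => av bv.
have := ratioQ b av; have := ratioQ a bv; have := diamQ a v; have := diamQ b v.
rewrite Qa Qb /sqdist; case: (Q v) => x y /= bv2 av2 bv1 av1.
(* Subtracting [|bv|^2 <= 128^2] from [|av|^2 >= 64^2] leaves [256 x >= - 3 * 64^2]. *)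
have x_ge : - 48 <= x by lra.
have x_le : x <= 48 by lra.
have y_ge : - 128 <= y by nra.
have y_le : y <= 128 by nra.
(* Here [(x + 64)^2 >= 64^2 - 36^2 > 52^2], and symmetrically for [64 - x]. *)
have x12 : `|y| <= 36 -> (- 12 <= x) && (x <= 12).
  by rewrite ler_norml => /andP[y1 y2]; apply/andP; split; nra.
have ZE : (real_of_Z R (Zneg 128) = - 128) * (real_of_Z R (Zneg 86) = - 86) *
    (real_of_Z R (Zneg 48) = - 48) * (real_of_Z R (Zneg 36) = - 36) *
    (real_of_Z R (Zneg 12) = - 12) * (real_of_Z R Z0 = 0) *
    (real_of_Z R (Zpos 12) = 12) * (real_of_Z R (Zpos 36) = 36) *
    (real_of_Z R (Zpos 48) = 48) * (real_of_Z R (Zpos 86) = 86) *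
    (real_of_Z R (Zpos 128) = 128) by [].
rewrite /zones /= /in_box /in_interval /= !ZE x_ge x_le y_ge y_le /= !andbT.
have [y36|y36] := lerP `|y| 36.
  have -> := x12 y36; move: y36; rewrite ler_norml => /andP[-> ->].
  by have [_|/ltW ->] := lerP 0 y; rewrite ?orbT.
move: y36; rewrite lter_normr => /orP[/ltW y36|y36].
  have [_|/ltW ->] := lerP y 86; last by rewrite !orbT.
  by rewrite y36; have [_|/ltW ->] := lerP x 0; rewrite !orbT.
have -> : y <= - 36 by lra.
have [_|/ltW ->] := lerP (- 86) y; last by rewrite !orbT.
by have [_|/ltW ->] := lerP x 0; rewrite !orbT.
Qed.

Lemma in_zone v : v != a -> v != b -> in_box (nth box0 zones (zone v)) (Q v).
Proof. by move=> va vb; apply: (nth_find _ (has_zone va vb)). Qed.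

Lemma zone_lt8 v : v != a -> v != b -> (zone v < 8)%N.
Proof. by move=> va vb; have := has_zone va vb; rewrite has_find. Qed.

Lemma clashF vs : uniq [:: a, b & vs] -> clash (map zone vs) = false.
Proof.
move=> uvs; apply/negP; rewrite /clash size_map => /and3P[/allP tsP /allP psP].
set us := [:: a, b & vs] in uvs.
pose P i := nth (0, 0) (map Q us) i.
have PE i : (i < (size vs).+2)%N -> P i = Q (nth a us i).
  by move=> i_lt; rewrite /P (nth_map a).
rewrite (@refuteF _ _ _ _ _ P) //.
- move=> t /tsP /and4P[ij i_lt j_lt k_lt]; rewrite !PE //; apply: ratioQ.
  by rewrite nth_uniq.
- by move=> t /psP /andP[i_lt j_lt]; rewrite !PE.
have ZE : (real_of_Z R (Zneg 64) = - 64) * (real_of_Z R Z0 = 0) *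
    (real_of_Z R (Zpos 64) = 64) by [].
case=> [|[|n]]; rewrite /P /= ?Qa ?Qb.
1,2: by rewrite /in_box /in_interval /= !ZE !lexx.
(* Past the end of the list, the default point is the origin and lies in the default box [box0]. *)
rewrite -map_comp; have [n_lt|n_ge] := ltnP n (size vs); last first.
  by rewrite !nth_default ?size_map // /in_box /in_interval /= !ZE !lexx.
rewrite !(nth_map a) //=.
have v_in : nth a vs n \in vs by rewrite mem_nth.
move: uvs; rewrite /us /= inE negb_or -andbA => /and4P[_ av bv _].
apply: in_zone; first by apply: contraNneq av => <-.
by apply: contraNneq bv => <-.
Qed.

Lemma card_normalized : (#|T| < 8)%N.
Proof.
rewrite ltnNge; apply/negP => T8.
have ab : a != b.
  apply/eqP => ab; have := Qa; rewrite ab Qb => -[]; lra.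
pose e := enum (~: [set a; b]).
have eP v : v \in e -> (v != a) && (v != b).
  by rewrite mem_enum !inE negb_or.
have e6 : (6 <= size e)%N.
  by rewrite -cardE cardsCs setCK cards2 ab (leq_sub2r 2 T8).
have e_uniq : uniq (map zone e).
  rewrite map_inj_in_uniq ?enum_uniq // => u v ue ve uv.
  have /andP[ua ub] := eP _ ue; have /andP[va vb] := eP _ ve.
  apply/eqP/negP => /negP nuv.
  have := @clashF [:: u; v]; rewrite /= !inE !negb_or ab ![_ == u]eq_sym.
  rewrite ![_ == v]eq_sym ua ub va vb [v == u]eq_sym nuv uv => /(_ isT).
  by rewrite (allP zone_clash) // mem_iota zone_lt8.
have /hasP[ks ksE /allP/map_lift[vs vsE vse]] :
    has (fun ks => all (mem (map zone e)) ks) exclusions.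
  apply: exclusion_six; rewrite ?size_map //.
  by apply/allP => _ /mapP[v /eP/andP[va vb] ->]; apply: zone_lt8.
have ks_uniq : uniq ks by move: ks ksE {vsE}; apply/allP.
have := allP exclusion_clash ks ksE; rewrite -vsE clashF //=.
rewrite inE negb_or ab (map_uniq (f := zone)) ?vsE // andbT.
by apply/andP; split; apply/negP => /vse /eP; rewrite eqxx ?andbF.
Qed.

End Normalized.

(** * Reduction of drawings to normalized position *)

Section EmptyPly.
Variables (R : realType) (n : nat) (p : 'I_n -> R * R).

Lemma sqdist_ge0 (u v : R * R) : 0 <= sqdist u v.
Proof. by rewrite addr_ge0 ?sqr_ge0. Qed.

Lemma sqdist_eq0 (u v : R * R) : (sqdist u v == 0) = (u == v).
Proof.
by rewrite paddr_eq0 ?sqr_ge0 // !sqrf_eq0 !subr_eq0; case: u v => ? ? [].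
Qed.

Lemma le_dist (k : R) (u v w : R * R) : 0 <= k ->
  (dist u w <= k * dist u v) = (sqdist u w <= k ^+ 2 * sqdist u v).
Proof.
move=> k0; rewrite -[RHS]ler_sqrt ?mulr_ge0 ?sqr_ge0 ?sqdist_ge0 //.
by rewrite sqrtrM ?sqr_ge0 // sqrtr_sqr ger0_norm.
Qed.

Lemma empty_ply_complete : @empty_ply R (complete_graph n) p <->
  forall u v w : 'I_n, u != v ->
    sqdist (p u) (p w) <= 4 * sqdist (p u) (p v).
Proof.
have E u v w : (dist (p u) (p w) <= 2 * dist (p u) (p v)) =
    (sqdist (p u) (p w) <= 4 * sqdist (p u) (p v)).
  by rewrite le_dist // -natrX.
split=> [ply u v w uv|ratio v u uv].
  (* The maximum in [longest_edge] omits [u] itself. *)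
  have [->|wu] := eqVneq w u.
    by rewrite {1}/sqdist !subrr expr0n /= addr0 mulr_ge0 ?sqdist_ge0.
  have vu : v != u by rewrite eq_sym.
  have := ply u v vu.
  rewrite /ply_disk /open_disk /= => /negP; rewrite -leNgt => le_uv.
  have le_uw : dist (p u) (p w) <= longest_edge (G := complete_graph n) p u.
    rewrite /longest_edge.
    apply: (@le_bigmax_cond _ _ _ _ w _ (fun x => dist (p u) (p x))).
    by rewrite /= eq_sym.
  by rewrite -E; lra.
apply/negP; rewrite -leNgt ler_pdivrMr // mulrC.
apply: bigmax_le => [|w _]; first by rewrite mulr_ge0 ?sqrtr_ge0.
by rewrite E ratio // eq_sym.
Qed.

Lemma empty_ply_card : injective p -> @empty_ply R (complete_graph n) p ->
  (n <= 7)%N.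
Proof.
move=> p_inj /empty_ply_complete ratio; rewrite leqNgt; apply/negP => n8.
have n0 : (0 < n)%N by apply: leq_trans n8.
have n1 : (1 < n)%N by apply: leq_trans n8.
pose i0 := Ordinal n0; pose i1 := Ordinal n1.
pose F (uv : 'I_n * 'I_n) := sqdist (p uv.1) (p uv.2).
have [[a b] _ /= abP] := @arg_maxP _ R _ (i0, i0) predT F isT.
have {}abP u v : sqdist (p u) (p v) <= sqdist (p a) (p b) := abP (u, v) isT.
have D0 : 0 < sqdist (p a) (p b).
  apply: lt_le_trans (abP i0 i1); rewrite lt_neqAle sqdist_ge0 eq_sym.
  by rewrite sqdist_eq0 (inj_eq p_inj).
set D := sqdist (p a) (p b) in abP D0.
pose X (v : 'I_n) := (p v).1 - ((p a).1 + (p b).1) / 2.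
pose Y (v : 'I_n) := (p v).2 - ((p a).2 + (p b).2) / 2.
pose e1 := (p b).1 - (p a).1; pose e2 := (p b).2 - (p a).2.
(* In complex notation, the similarity [z -> 128 (z - m) / (b - a)] with [m] the midpoint of the
   farthest pair; the division is by way of the conjugate of [b - a]. *)
pose Q v := (128 * (X v * e1 + Y v * e2) / D, 128 * (Y v * e1 - X v * e2) / D).
have DE : D = e1 ^+ 2 + e2 ^+ 2 by rewrite /D /sqdist /e1 /e2; ring.
have D_neq0 : e1 ^+ 2 + e2 ^+ 2 != 0 by rewrite -DE gt_eqF.
have QE u v : sqdist (Q u) (Q v) = 128 ^+ 2 / D * sqdist (p u) (p v).
  rewrite /sqdist /Q /= DE /X /Y; field; exact: D_neq0.
have cD : 0 < 128 ^+ 2 / D by rewrite divr_gt0 // exprn_gt0.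
suff : (#|'I_n| < 8)%N by rewrite card_ord ltnNge n8.
apply: (@card_normalized R _ Q a b).
- congr (_, _); last by rewrite /X /Y /e1 /e2; field; rewrite gt_eqF.
  by rewrite DE /X /Y /e1 /e2 in D_neq0 *; field.
- congr (_, _); last by rewrite /X /Y /e1 /e2; field; rewrite gt_eqF.
  by rewrite DE /X /Y /e1 /e2 in D_neq0 *; field.
- by move=> u v w uv; rewrite !QE mulrCA ler_pM2l // ratio.
- move=> u v; rewrite QE -mulrA ler_piMr ?exprn_ge0 //.
  by rewrite mulrC ler_pdivrMr // mul1r.
Qed.

End EmptyPly.

(** * Drawings with at most seven vertices *)

Definition centred_hexagon (R : realType) : seq (R * R) :=
  let s := Num.sqrt 3 in
  [:: (0, 0); (2, 0); (1, s); (- 1, s); (- 2, 0); (- 1, - s); (1, - s)].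

(** The side is 2 and the squared distances are 4, 12 and 16, so each is at most four times any
    other. *)
Lemma centred_hexagon_sqdist (R : realType) (i j : nat) :
  (i < 7)%N -> (j < 7)%N -> i != j ->
  4 <= sqdist (nth (0, 0) (centred_hexagon R) i)
              (nth (0, 0) (centred_hexagon R) j) <= 16.
Proof.
have s3 : (Num.sqrt 3 : R) ^+ 2 = 3 by rewrite sqr_sqrtr.
rewrite /sqdist /centred_hexagon; set s := Num.sqrt 3 in s3 *.
move: i j => [|[|[|[|[|[|[|//]]]]]]] [|[|[|[|[|[|[|//]]]]]]] // _ _ _ /=.
all: apply/andP; split; nra.
Qed.

Theorem theorem4 (R : realType) (n : nat) :
  admits_empty_ply_drawing R (complete_graph n) <-> (n <= 7)%N.
Proof.
split=> [[p [p_inj ply]]|n7]; first exact: empty_ply_card ply.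
pose p (i : 'I_n) := nth (0, 0) (centred_hexagon R) i.
have i7 (i : 'I_n) : (i < 7)%N by apply: leq_trans n7.
exists p; split.
  move=> i j ij; apply/val_inj/eqP; apply: contraTT isT => nij.
  have /andP[] := centred_hexagon_sqdist R (i7 i) (i7 j) nij.
  by rewrite -/(p i) -/(p j) ij /sqdist !subrr; lra.
apply/empty_ply_complete => u v w uv.
have /andP[uv4 _] := centred_hexagon_sqdist R (i7 u) (i7 v) uv.
have [->|uw] := eqVneq u w.
  by rewrite {1}/sqdist !subrr expr0n /= addr0 mulr_ge0 ?sqdist_ge0.
have /andP[_] := centred_hexagon_sqdist R (i7 u) (i7 w) uw.
by rewrite -/(p u) -/(p v) -/(p w) in uv4 *; lra.
Qed.
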